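(* Let $\mathcal{C}$ be a closed set of distributions of $CZ$, let $\rho\in\mathcal{C}$, and let $g$ be the asymptotic gain rate at $\rho$ of $\mathcal{C}$. (1) For all distributions $\nu$ of $CZE$ (with $E$ any random variable with finite value space) such that $\nu[CZ]=\rho$ and $\nu[CZ|E=e]\in\mathcal{C}$ for all $e$ with $\nu(e)>0$, we have $g\le H(D|ZE;\nu)$. (2) For $|\mathrm{Rng}(E)|$ sufficiently large, there is a distribution $\nu$ of $CZE$ with $\nu[CZ]=\rho$ and $\nu[CZ|E=e]\in\mathcal{C}$ for all $e$ with $\nu(e)>0$ such that $g=H(D|ZE;\nu)$.
   Context: All random variables have finite value spaces; $\mathrm{Rng}(X)$ is the value space of $X$. $D$ is a function of $C$. Logarithms are natural, $\log 0=-\infty$. Expectations are sums over values of positive probability only. $\nu[X]$ is the marginal distribution of $X$ and $\nu[X|E=e]$ the conditional distribution. PEF: for $\beta>0$, a probability estimation factor with power $\beta$ for $\mathcal{C}$ (and $D|Z$) is a non-negative function $F=F(CZ)$ such that $\mathbb{E}_\sigma(F(CZ)\,\sigma(D|Z)^\beta)\le1$ for all $\sigma\in\mathcal{C}$. Its log-prob rate at $\rho$ is $\mathcal{O}_\rho(F;\beta)=\mathbb{E}_\rho(\log F(CZ))/\beta$. The asymptotic gain rate at $\rho$ of $\mathcal{C}$ is the supremum of the log-prob rates at $\rho$ achievable by PEFs with positive power for $\mathcal{C}$ (supremum over all $\beta>0$ and all PEFs with power $\beta$). Conditional entropy: $H(D|ZE;\nu)=\mathbb{E}_\nu(-\log\nu(D|ZE))$.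 *)

(* Defs.v *)
From HB Require Import structures.
From mathcomp Require Import all_boot all_order all_algebra.
From mathcomp Require Import all_classical all_reals all_analysis.

Set Implicit Arguments.
Unset Strict Implicit.
Unset Printing Implicit Defensive.

Import Order.TTheory GRing.Theory Num.Theory.
Import numFieldNormedType.Exports.

Local Open Scope classical_set_scope.
Local Open Scope ring_scope.

(* A distribution on a finite value space Om is given by its probability mass
   function p : Om -> R.  Random variables are functions X : Om -> A, and an
   expression in them such as "p(X | Y)" is the function
   w |-> p(X = X w | Y = Y w). *)

Definition is_distr (R : realType) (Om : finType) (p : Om -> R) : Prop :=
  (forall w, 0 <= p w) /\ \sum_w p w = 1.

Definition marg (R : realType) (Om A : finType) (p : Om -> R) (X : Om -> A) :
  A -> R := fun a => \sum_(w | X w == a) p w.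

(* p[X | Y = y], meaningful when p(Y = y) > 0 (it is the zero function
   otherwise, as 0^-1 = 0). *)
Definition cond (R : realType) (Om A B : finType) (p : Om -> R)
    (X : Om -> A) (Y : Om -> B) (y : B) : A -> R :=
  fun x => marg p (fun w => (X w, Y w)) (x, y) / marg p Y y.

(* The sum is restricted to outcomes of positive probability; f is
   extended-real valued because log 0 = -oo may occur. *)
Definition expect (R : realType) (Om : finType) (p : Om -> R)
    (f : Om -> \bar R) : \bar R :=
  (\sum_(w | (0 < p w)%R) (p w)%:E * f w)%E.

Definition cond_entropy (R : realType) (Om A B : finType) (p : Om -> R)
    (X : Om -> A) (Y : Om -> B) : \bar R :=
  expect p (fun w => - lne (cond p X Y (Y w) (X w))%:E)%E.

(* The random variable D is the function d of C. *)

Definition is_PEF (R : realType) (C Z D : finType) (d : C -> D)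
    (M : set (C * Z -> R)) (beta : R) (F : C * Z -> R) : Prop :=
  (forall cz, 0 <= F cz) /\
  (forall sigma, M sigma ->
    (expect sigma (fun cz =>
       (F cz * cond sigma (fun w => d w.1) snd cz.2 (d cz.1) `^ beta)%:E)
     <= 1)%E).

Definition log_prob_rate (R : realType) (C Z : finType) (rho : C * Z -> R)
    (beta : R) (F : C * Z -> R) : \bar R :=
  (expect rho (fun cz => lne (F cz)%:E) * (beta^-1)%:E)%E.

Definition asymptotic_gain_rate (R : realType) (C Z D : finType) (d : C -> D)
    (M : set (C * Z -> R)) (rho : C * Z -> R) : \bar R :=
  ereal_sup [set r | exists beta F,
    [/\ 0 < beta, is_PEF d M beta F & r = log_prob_rate rho beta F]].

Definition is_extension (R : realType) (C Z E : finType)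
    (M : set (C * Z -> R)) (rho : C * Z -> R) (nu : C * Z * E -> R) : Prop :=
  [/\ is_distr nu,
      marg nu fst = rho &
      forall e, 0 < marg nu snd e -> M (cond nu fst snd e)].

Definition entropy_D_ZE (R : realType) (C Z D E : finType) (d : C -> D)
    (nu : C * Z * E -> R) : \bar R :=
  cond_entropy nu (fun w => d w.1.1) (fun w => (w.1.2, w.2)).

(* Main.v *)
(* A PEF F with power beta and Jensen's inequality for log give, for every
   sigma in M, E_sigma (log F) / beta <= H(D|Z; sigma); averaging over the
   conditional distributions sigma_e of an extension nu gives (1).

   For (2), minimise sum_e w_e H(D|Z; sigma_e) over the decompositions
   rho = sum_e w_e sigma_e with sigma_e in M.  The minimum v is attained because
   M is compact, and by Caratheodory's theorem the mixtures of |C x Z| + 1 points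
   of the graph of sigma |-> H(D|Z; sigma) already form a convex set.  Separating
   this set from (rho, v - eps) yields a function f of CZ with
   E_sigma f <= H(D|Z; sigma) on M and E_rho f = v - eps; the separating
   hyperplane is not vertical because rho itself belongs to M.  A second-order
   expansion of exp in beta shows that exp (beta (f - eps)) is a PEF with power
   beta for small beta, and its log-prob rate at rho is v - 2 eps. *)

Require Import Defs.
From mathcomp Require Import all_boot all_order all_algebra.
From mathcomp Require Import all_classical all_reals all_analysis.
From mathcomp Require Import ring lra.
Import Order.TTheory GRing.Theory Num.Theory.
Import numFieldNormedType.Exports.

Set Implicit Arguments.
Unset Strict Implicit.
Unset Printing Implicit Defensive.

Local Open Scope classical_set_scope.
Local Open Scope ring_scope.

(** * Elementary inequalities for exp and log *)

Section real_inequalities.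
Context {R : realType}.
Implicit Types x s : R.

(** Invert and square exp (-x/2) >= 1 - x/2; the difference (1 + x + x^2)(1 - x/2)^2 - 1 = x^2 (1 -
    3x + x^2) / 4 is nonnegative for x <= 1/3. No lower bound is imposed on x, since logarithms of
    small probabilities will enter it. *)
Lemma expR_le_quadratic x : x <= 3^-1 -> expR x <= 1 + x + x ^+ 2.
Proof.
move=> x3; have -> : x = x / 2 + x / 2 by lra.
rewrite expRD -[expR _]invrK -expRN -invfM.
have le1 := expR_ge1Dx (- (x / 2)).
have pos : 0 < 1 - x / 2 by lra.
rewrite -[leLHS]mul1r ler_pdivrMr ?mulr_gt0 ?expR_gt0//.
apply: (@le_trans _ _ ((1 + x + x ^+ 2) * ((1 - x / 2) * (1 - x / 2)))); last first.
  have -> : x / 2 + x / 2 = x by lra.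
  apply: ler_wpM2l; first by nra.
  by apply: ler_pM => //; lra.
have : 0 <= 1 - 3 * x + x ^+ 2 by nra.
have : 0 <= x ^+ 2 by exact: sqr_ge0.
move=> h1 h2; rewrite -subr_ge0.
have -> : (1 + x + x ^+ 2) * ((1 - x / 2) * (1 - x / 2)) - 1 =
  4^-1 * (x ^+ 2 * (1 - 3 * x + x ^+ 2)) by field.
by rewrite mulr_ge0// mulr_ge0.
Qed.

(** With y = - ln s / 2, the bound y <= exp y gives y^2 <= 1 / s, while ln^2 s = 4 y^2. *)
Lemma mulr_ln_sqr_le4 s : 0 < s -> s <= 1 -> s * ln s ^+ 2 <= 4.
Proof.
move=> s0 s1; pose y := - ln s / 2.
have y0 : 0 <= y by rewrite /y divr_ge0// oppr_ge0 ln_le0.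
have y_le : y <= expR y by have := expR_ge1Dx y; lra.
have ey : expR y * expR y = s^-1.
  rewrite -expRD (_ : y + y = - ln s); last by rewrite /y; lra.
  by rewrite expRN lnK.
have -> : ln s = - 2 * y by rewrite /y; lra.
have : y * y <= s^-1 by rewrite -ey ler_pM.
rewrite -(ler_pM2l s0) mulfV ?gt_eqF// => h.
by rewrite exprMn; nra.
Qed.

(* As ln vanishes on nonpositive reals, continuity holds on the whole line. *)
Lemma continuous_mulr_ln : continuous (fun x : R => x * ln x).
Proof.
move=> x; have [x0|x0|->] := ltgtP x 0.
- rewrite /continuous_at (ln0 (ltW x0)) mulr0; apply: cvg_near_cst.
  by near=> y; rewrite ln0 ?mulr0// ltW//; near: y; exact: lt_nbhsl.
- by apply: cvgM; [exact: cvg_id | exact: continuous_ln].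
- rewrite /continuous_at mul0r; apply/cvgrPdist_le => /= e e0; near=> y.
  rewrite sub0r normrN; have [y0|y0] := leP y 0.
    by rewrite ln0// mulr0 normr0 ltW.
  have y1 : y <= 1 by rewrite ltW//; near: y; exact: lt_nbhsl.
  (* By [mulr_ln_sqr_le4], (y ln y)^2 = y (y ln^2 y) <= 4 y, which is then at most e^2. *)
  have ye : y <= e ^+ 2 / 4.
    by rewrite ltW//; near: y; apply: lt_nbhsl; rewrite divr_gt0// exprn_gt0.
  rewrite -(@ler_pXn2r _ 2) ?nnegrE ?normr_ge0 ?(ltW e0)// real_normK ?num_real//.
  rewrite exprMn expr2 -mulrA.
  by have := ler_wpM2l (ltW y0) (mulr_ln_sqr_le4 y0 y1); lra.
Unshelve. all: by end_near. Qed.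

End real_inequalities.

(** * Caratheodory's theorem for cones *)

(** More vectors than coordinates satisfy a nontrivial linear relation, with a positive coefficient
    up to sign. Moving [w] along it until a weight reaches zero changes no combination. *)
Lemma conic_caratheodory (R : realFieldType) (I J : finType) (w : I -> R)
    (v : I -> J -> R) :
  (#|J| < #|I|)%N -> (forall i, 0 <= w i) ->
  exists w' i0, [/\ forall i, 0 <= w' i, w' i0 = 0 &
    forall j, \sum_i w' i * v i j = \sum_i w i * v i j].
Proof.
move=> JI w0.
have [c [[k ck] cv]] : exists c : I -> R, (exists k, 0 < c k) /\
    forall j, \sum_i c i * v i j = 0.
  pose A := \matrix_(i < #|I|, j < #|J|) v (enum_val i) (enum_val j).
  have : kermx A != 0.
    rewrite -mxrank_eq0 mxrank_ker subn_eq0 -ltnNge.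
    by rewrite (leq_ltn_trans (rank_leq_col _)).
  case/matrix0Pn => r [k rk].
  pose c i : R := kermx A r (enum_rank i).
  have cv j : \sum_i c i * v i j = 0.
    have /matrixP/(_ r (enum_rank j)) := mulmx_ker A.
    rewrite mxE [RHS]mxE => E; rewrite -[RHS]E (reindex (@enum_rank I)) /=; last first.
      by apply: onW_bij; exact: enum_rank_bij.
    by apply: eq_bigr => i _; rewrite [A _ _]mxE !enum_rankK.
  have ck : c (enum_val k) != 0 by rewrite /c enum_valK.
  case: (ltgtP (c (enum_val k)) 0) ck => // ck _; last first.
    by exists c; split => //; exists (enum_val k).
  exists (fun i => - c i); split; first by exists (enum_val k); rewrite oppr_gt0.
  by move=> j; under eq_bigr do rewrite mulNr; rewrite sumrN cv oppr0.
(* The smallest ratio is the largest step that keeps all weights nonnegative; it kills the weight of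
   its index [i0]. *)
case: (@arg_minP _ _ _ k (fun i => 0 < c i) (fun i => w i / c i) ck) => i0 ci0 i0min.
exists (fun i => w i - w i0 / c i0 * c i), i0; split.
- move=> i; rewrite subr_ge0; have [ci|ci] := leP (c i) 0.
    by rewrite (le_trans _ (w0 i))// mulr_ge0_le0// divr_ge0// ltW.
  by rewrite -ler_pdivlMr// i0min.
- by rewrite divfK ?subrr// gt_eqF.
- move=> j; under eq_bigr do rewrite mulrBl -[_ * c _ * _]mulrA.
  by rewrite sumrB /= -mulr_sumr cv mulr0 subr0.
Qed.

(** * Product topology, finite sums and first-order optimality *)

Lemma continuous_ptws_eval (R : realType) (I : eqType) (i : I) :
  continuous (fun x : {ptws I -> R} => x i).
Proof. exact: (@proj_continuous I (fun=> R) i). Qed.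

Lemma continuous_ptws (R : realType) (T : topologicalType) (I : eqType)
    (f : T -> {ptws I -> R}) :
  (forall i, continuous (fun t => f t i)) -> continuous f.
Proof.
move=> fc t; apply/cvg_sup => i U [V] [[W] oW <-] Wft WU.
have /(fc i t) : nbhs (f t i) W by apply: open_nbhs_nbhs.
apply: (@filterS _ (nbhs t)) => y Wy; exact: WU.
Qed.

Lemma continuous_sumr (R : realType) (T : topologicalType) (I : finType)
    (F : I -> T -> R) :
  (forall i, continuous (F i)) -> continuous (fun x => \sum_i F i x).
Proof. by move=> Fc; apply: continuous_big => //; exact: add_continuous. Qed.

Lemma sumr_option (V : zmodType) (T : finType) (F : option T -> V) :
  \sum_i F i = F None + \sum_t F (Some t).
Proof.
rewrite (bigD1 None)//= (reindex_omap Some id) => [|[]]//.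
by congr (_ + _); apply: eq_bigl => t; rewrite /= eqxx.
Qed.

(** The sum is half the derivative at t = 0 of the squared norm of a + t b, so a negative value
    would contradict minimality. *)
Lemma ge0_sum_mul_of_sqr_min (R : realFieldType) (J : finType) (a b : J -> R) :
  (forall t, 0 <= t <= 1 -> \sum_j a j ^+ 2 <= \sum_j (a j + t * b j) ^+ 2) ->
  0 <= \sum_j a j * b j.
Proof.
move=> min; set A := \sum_j _; pose B := \sum_j b j ^+ 2.
have B0 : 0 <= B by apply: sumr_ge0 => j _; exact: sqr_ge0.
rewrite leNgt; apply/negP => A0.
(* For this t one has t B = - A + t A, so 2 A + t B = (1 + t) A is negative; B >= 0 ensures t <=
   1. *)
pose t := - A / (B - A).
have BA : 0 < B - A by lra.
have t0 : 0 < t by rewrite divr_gt0// oppr_gt0.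
have t1 : t <= 1 by rewrite ler_pdivrMr//; lra.
have tBA : t * (B - A) = - A by rewrite divfK// gt_eqF.
have /min : 0 <= t <= 1 by rewrite t1 ltW.
have -> : \sum_j (a j + t * b j) ^+ 2 =
    \sum_j a j ^+ 2 + t * (2 * A + t * B).
  rewrite mulrDr !mulr_sumr -!big_split /=; apply: eq_bigr => j _; ring.
rewrite lerDl pmulr_rge0// => le; nra.
Qed.

(** * Optimal mixtures of graph points and separating functionals *)

Section convex_roof.
Context {R : realType} {Om : finType} (E : finType).
Variables (M : set (Om -> R)) (h : {ptws Om -> R} -> R).
Hypotheses (M_distr : forall sigma, M sigma -> is_distr sigma)
  (M_closed : closed (M : set {ptws Om -> R})) (h_cont : continuous h).

(* An E-indexed weighted family of functions on Om, kept in a single product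
   space so that Tychonoff's theorem applies: the value at (e, None) is the
   weight of e and the values at (e, Some o) are those of its atom. *)
Definition family := {ptws (E * option Om)%type -> R}.

Definition atom (e : E) (x : family) : {ptws Om -> R} :=
  fun o => x (e, Some o).

(** A single index type covers the base point ([Some]) and the height ([None]), so Caratheodory and
    separation treat both at once. *)
Definition graph_coord (j : option Om) (s : {ptws Om -> R}) : R :=
  if j is Some o then s o else h s.

Definition mixture (j : option Om) (x : family) : R :=
  \sum_e x (e, None) * graph_coord j (atom e x).

(** Atoms of weight zero must lie in [M] too, which keeps the set closed and all its coordinates
    bounded. *)
Definition families : set family :=
  [set x | [/\ forall e, 0 <= x (e, None), \sum_e x (e, None) = 1 &
               forall e, M (atom e x)]].

Lemma continuous_atom e : continuous (atom e).
Proof.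
by apply: continuous_ptws => o; exact: continuous_ptws_eval.
Qed.

Lemma continuous_graph_coord j : continuous (graph_coord j).
Proof. by case: j => [u|] //; exact: continuous_ptws_eval. Qed.

Lemma continuous_mixture j : continuous (mixture j).
Proof.
apply: continuous_sumr => e x.
have cont_weight : continuous (fun x : family => x (e, None)).
  exact: continuous_ptws_eval.
apply: (cvgM (cont_weight x) (_ : graph_coord j \o atom e @ x --> _)).
apply: (@continuous_comp _ _ _ (atom e) (graph_coord j)).
  exact: continuous_atom.
exact: continuous_graph_coord.
Qed.

(** A closed subset of the unit cube: weights and atoms are distributions, and every condition is
    the preimage of a closed set under a continuous map. *)
Lemma compact_families : compact families.
Proof.
have cpt : compact [set x : family | forall i, `[0, 1]%classic (x i)].
  by apply: (@tychonoff _ (fun=> R) (fun=> `[0, 1]%classic)) => i; exact: segment_compact.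
apply: subclosed_compact cpt _; last first.
  move=> x [x0 x1 xM] [e j] /=; rewrite in_itv /=; case: j => [u|].
    have [s0 s1] := M_distr (xM e).
    by rewrite (s0 u) -s1 (bigD1 u)//= lerDl sumr_ge0.
  by rewrite x0 -x1 (bigD1 e)//= lerDl sumr_ge0.
have -> : families =
  (\bigcap_e (fun x : family => x (e, None)) @^-1` [set r | 0 <= r]) `&`
  ((fun x : family => \sum_e x (e, None)) @^-1` [set 1]) `&`
  (\bigcap_e (atom e) @^-1` M).
  apply/seteqP; split=> x /=.
    by case=> x0 x1 xM; split; [split=> // e _; exact: x0|move=> e _; exact: xM].
  by case=> -[x0 x1] xM; split=> // e; [exact: x0|exact: xM].
apply: closedI; [apply: closedI|].
- apply: closed_bigI => e _; apply: preimage_closed; last exact: closed_ge.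
  by move=> x _; exact: continuous_ptws_eval.
- apply: preimage_closed; last exact: closed_eq.
  by move=> x _; apply: continuous_sumr => e; exact: continuous_ptws_eval.
- apply: closed_bigI => e _; apply: preimage_closed M_closed.
  by move=> x _; exact: continuous_atom.
Qed.

Definition dirac_family (e0 : E) (s : Om -> R) : family :=
  fun p => if p.2 is Some o then s o else (p.1 == e0)%:R.

Lemma dirac_family_in e0 s : M s -> families (dirac_family e0 s).
Proof.
move=> Ms; split=> [e| |e] //.
rewrite (bigD1 e0)//= /dirac_family /= eqxx big1 ?addr0// => e.
by move=> /negPf ->.
Qed.

Lemma mixture_dirac e0 s j : mixture j (dirac_family e0 s) = graph_coord j s.
Proof.
rewrite /mixture (bigD1 e0)//= /dirac_family /= eqxx mul1r big1 ?addr0// => e.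
by move=> /negPf ->; rewrite mul0r.
Qed.

(* The atoms of x together with s form a family indexed by option E; since the
   graph lives in dimension #|Om| + 1, Caratheodory frees one index, which s can
   take over if it is not its own. *)
Lemma mixture_convex x s (t : R) : (#|Om| < #|E|)%N ->
  families x -> M s -> 0 <= t <= 1 ->
  exists2 y, families y &
    forall j, mixture j y = (1 - t) * mixture j x + t * graph_coord j s.
Proof.
move=> cardE [x0 x1 xM] Ms /andP[t0 t1].
pose w i := if i is Some e then (1 - t) * x (e, None) else t.
pose v i : Om -> R := if i is Some e then atom e x else s.
have vM i : M (v i) by case: i => [e|] //=; exact: xM.
have w0 i : 0 <= w i by case: i => [e|] //=; rewrite mulr_ge0// subr_ge0.
have card_lt : (#|{: option Om}| < #|{: option E}|)%N by rewrite !card_option.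
have [w' [i0 [w'0 w'i0 w'E]]] :=
  conic_caratheodory (fun i j => graph_coord j (v i)) card_lt w0.
(* [pos] is a bijection from [E] onto [option E] without [i0]; when [i0] is an index of [E], its
   slot receives the new point [s]. *)
pose pos e := if Some e == i0 then None else Some e.
have sumE (F : option E -> R) : F i0 = 0 -> \sum_i F i = \sum_e F (pos e).
  move=> F0; rewrite (bigD1 i0)//= F0 add0r.
  rewrite (reindex_omap pos (fun i => if i is Some e then Some e else i0)) /=.
    apply: eq_bigl => e; rewrite /pos; case: (eqVneq (Some e) i0) => [<-|ne].
      by rewrite !eqxx.
    by rewrite ne eqxx.
  case=> [e /negPf|] /=; first by rewrite /pos => ->.
  by rewrite /pos; case: i0 {w'i0 pos F0} => [e0|]; rewrite /= ?eqxx.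
have convE j : \sum_i w i * graph_coord j (v i) =
    (1 - t) * mixture j x + t * graph_coord j s.
  rewrite sumr_option addrC /mixture mulr_sumr; congr (_ + _).
  by apply: eq_bigr => e _; rewrite mulrA.
pose y : family := fun p =>
  if p.2 is Some o then v (pos p.1) o else w' (pos p.1).
have yE j : mixture j y = \sum_i w' i * graph_coord j (v i).
  by rewrite sumE ?w'i0 ?mul0r.
exists y => [|j]; last by rewrite yE w'E convE.
split => [e||e]; [exact: w'0| |exact: (vM (pos e))].
(* The total weight is preserved without a coordinate of its own: each [v i] sums to 1, so the total
   is the sum of the preserved base coordinates. *)
have coord_sum i : \sum_o graph_coord (Some o) (v i) = 1.
  by have [] := M_distr (vM i).
have total (u : option E -> R) :
    \sum_i u i = \sum_o \sum_i u i * graph_coord (Some o) (v i).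
  rewrite exchange_big; apply: eq_bigr => i _.
  by rewrite -mulr_sumr coord_sum mulr1.
rewrite -(sumE w')// total; under eq_bigr do rewrite w'E.
rewrite -total sumr_option /= -mulr_sumr x1; lra.
Qed.

Section minimum.
Variables (rho : Om -> R) (rho_M : M rho) (cardE : (#|Om| < #|E|)%N).

Let e0 : E := enum_val (Ordinal (leq_ltn_trans (leq0n #|Om|) cardE)).

(** The point (rho, v - eps) is not a mixture, as v bounds the heights over rho from below. Its
    displacement [a] to the nearest mixture is normal to a separating hyperplane, which is then
    solved for the height. *)
Lemma separating_functional (v eps : R) : 0 < eps ->
  (forall x, families x -> (forall o, mixture (Some o) x = rho o) ->
    v <= mixture None x) ->
  exists f : Om -> R,
    (forall s, M s -> \sum_o s o * f o <= h s) /\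
    \sum_o rho o * f o = v - eps.
Proof.
move=> eps0 v_le.
pose p j := if j is Some o then rho o else v - eps.
pose dist x := \sum_j (mixture j x - p j) ^+ 2.
have dist_cont : continuous dist.
  apply: continuous_sumr => j x.
  have c : (fun x => mixture j x - p j) @ x --> mixture j x - p j.
    exact: (cvgB (@continuous_mixture j x) (cvg_cst (p j))).
  exact: (cvgM c c).
have [x /set_mem xF x_min] := compact_EVT_min
  (ex_intro _ _ (dirac_family_in e0 rho_M)) compact_families
  (continuous_subspaceT dist_cont).
pose a j := mixture j x - p j.
have a_pos : 0 < \sum_j a j ^+ 2.
  rewrite lt_neqAle sumr_ge0 ?andbT => [|j _]; last exact: sqr_ge0.
  apply/eqP => /esym/eqP; rewrite psumr_eq0 => [/allP a0|j _]; last exact: sqr_ge0.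
  have {}a0 j : mixture j x = p j.
    apply/eqP; rewrite -subr_eq0 -sqrf_eq0.
    by apply: (a0 j); rewrite mem_index_enum.
  have := v_le x xF (fun o => a0 (Some o)); rewrite (a0 None) /=; lra.
(* The sum minus |a|^2 is the inner product of [a] with the direction from the nearest mixture to
   the graph point; it is nonnegative by minimality along that segment. *)
have sep s : M s -> 0 < \sum_j a j * (graph_coord j s - p j).
  move=> Ms; apply: (lt_le_trans a_pos); rewrite -subr_ge0 -sumrB.
  under eq_bigr do rewrite expr2 -mulrBr opprB addrA subrK.
  apply: ge0_sum_mul_of_sqr_min => t t01.
  have [y yF yE] := mixture_convex cardE xF Ms t01.
  apply: le_trans (x_min y (mem_set yF)) _; rewrite le_eqVlt; apply/orP; left.
  by apply/eqP; apply: eq_bigr => j _; rewrite yE /a; ring.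
have h_rho : v <= h rho.
  rewrite -[leRHS](mixture_dirac e0 rho None); apply: v_le => [|o].
    exact: dirac_family_in.
  exact: mixture_dirac.
(* At s = rho the base coordinates cancel, leaving [a None] times the positive number h rho - v +
   eps: the hyperplane is not vertical. *)
have b0 : 0 < a None.
  have := sep _ rho_M; rewrite sumr_option /= big1 => [|o _].
    by rewrite addr0 pmulr_lgt0//; lra.
  by rewrite subrr mulr0.
(* The constant term of the affine minorant; it can be absorbed into f because every s in [M] sums
   to 1. *)
pose k := v - eps + (\sum_o a (Some o) * rho o) / a None.
exists (fun o => k - a (Some o) / a None).
have sumE s : M s -> \sum_o s o * (k - a (Some o) / a None) =
    k - (\sum_o a (Some o) * s o) / a None.
  move=> /M_distr[_ s1]; under eq_bigr do rewrite mulrBr.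
  rewrite sumrB -mulr_suml s1 mul1r mulr_suml; congr (_ - _).
  by apply: eq_bigr => o _; rewrite mulrCA mulrA.
split=> [s Ms|]; last by rewrite sumE// /k; ring.
rewrite sumE// /k -addrA -mulrBl -lerBrDl ler_pdivrMr// -sumrB.
have := sep _ Ms; rewrite sumr_option /=.
under eq_bigr do rewrite mulrBr.
rewrite !sumrB; lra.
Qed.

(** Compactness of the fibre over rho gives a minimiser. The slack eps remains because a supporting
    hyperplane at the minimum itself may be vertical. *)
Lemma optimal_mixture : exists x, [/\ families x,
  forall o, mixture (Some o) x = rho o &
  forall eps, 0 < eps -> exists f : Om -> R,
    (forall s, M s -> \sum_o s o * f o <= h s) /\
    \sum_o rho o * f o = mixture None x - eps].
Proof.
pose A := families `&` \bigcap_o mixture (Some o) @^-1` [set rho o].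
have A_compact : compact A.
  apply: compact_closedI compact_families _; apply: closed_bigI => o _.
  by apply: preimage_closed (@closed_eq _ _) => x _; exact: continuous_mixture.
have A0 : A !=set0.
  exists (dirac_family e0 rho); split; first exact: dirac_family_in.
  by move=> o _; exact: mixture_dirac.
have [x /set_mem[xF xrho] x_min] := compact_EVT_min A0 A_compact
  (continuous_subspaceT (@continuous_mixture None)).
exists x; split=> // [u|eps eps0]; first exact: xrho.
apply: separating_functional => // y yF yrho; apply: x_min; apply: mem_set.
by split=> // o _; exact: yrho.
Qed.

End minimum.
End convex_roof.

(** * Conditional entropy: chain rule, continuity and mixtures *)

Section conditional_entropy.
Context {R : realType}.

Lemma marg_sum (Om A : finType) (p : Om -> R) (X : Om -> A) (g : A -> R) :
  \sum_w p w * g (X w) = \sum_x marg p X x * g x.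
Proof.
rewrite (partition_big X xpredT)//=; apply: eq_bigr => x _.
by rewrite /marg mulr_suml; apply: eq_bigr => w /eqP ->.
Qed.

Lemma sum_marg (Om A : finType) (p : Om -> R) (X : Om -> A) :
  \sum_x marg p X x = \sum_w p w.
Proof. by rewrite [RHS](partition_big X xpredT). Qed.

Lemma le_marg (Om A : finType) (p : Om -> R) (X : Om -> A) w :
  (forall w, 0 <= p w) -> p w <= marg p X (X w).
Proof. by move=> p0; rewrite /marg (bigD1 w)//= lerDl sumr_ge0. Qed.

Section general.
Context {Om A B : finType}.
Implicit Types (p : Om -> R) (X : Om -> A) (Y : Om -> B).

Definition cond_at p X Y (w : Om) : R := cond p X Y (Y w) (X w).

(** Real-valued form of [cond_entropy]: on the support of a nonnegative [p] the logarithm is finite,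
    and elsewhere its default value is multiplied by zero. *)
Definition rentropy p X Y : R := \sum_w p w * - ln (cond_at p X Y w).

Lemma le_marg_pair p X Y w : (forall w, 0 <= p w) ->
  marg p (fun w => (X w, Y w)) (X w, Y w) <= marg p Y (Y w).
Proof.
move=> p0; rewrite /marg big_mkcond [leRHS]big_mkcond; apply: ler_sum => u _.
by rewrite xpair_eqE; case: (X u == _); case: (Y u == _) => //=.
Qed.

Lemma cond_at_gt0 p X Y w : (forall w, 0 <= p w) -> 0 < p w ->
  0 < cond_at p X Y w.
Proof.
move=> p0 pw; rewrite /cond_at /cond divr_gt0//.
  exact: (lt_le_trans pw (le_marg (fun w => (X w, Y w)) w p0)).
exact: (lt_le_trans pw (le_marg Y w p0)).
Qed.

Lemma cond_at_le1 p X Y w : (forall w, 0 <= p w) -> 0 < p w ->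
  cond_at p X Y w <= 1.
Proof.
move=> p0 pw; rewrite /cond_at /cond ler_pdivrMr ?mul1r ?le_marg_pair//.
exact: (lt_le_trans pw (le_marg Y w p0)).
Qed.

(** Lets the weight [p w] be replaced by the conditional probability, so that [mulr_ln_sqr_le4]
    bounds second-order terms uniformly in [p]. *)
Lemma le_cond_at p X Y w : is_distr p -> 0 < p w -> p w <= cond_at p X Y w.
Proof.
move=> [p0 p1] pw; rewrite /cond_at /cond.
have mY : 0 < marg p Y (Y w) by exact: (lt_le_trans pw (le_marg Y w p0)).
have mY1 : marg p Y (Y w) <= 1.
  by rewrite -p1 /marg [leLHS]big_mkcond ler_sum// => u _; case: ifP.
have mXY : p w <= marg p (fun w => (X w, Y w)) (X w, Y w).
  exact: (le_marg (fun w => (X w, Y w)) w p0).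
rewrite ler_pdivlMr//; apply: le_trans mXY.
by rewrite ler_piMr// ltW.
Qed.

(** The chain rule H(X|Y) = H(XY) - H(Y). Only t ln t of marginals occurs, so continuity can be read
    off without dividing by marginals. *)
Lemma rentropyE p X Y : (forall w, 0 <= p w) ->
  rentropy p X Y = \sum_y marg p Y y * ln (marg p Y y) -
    \sum_xy marg p (fun w => (X w, Y w)) xy *
      ln (marg p (fun w => (X w, Y w)) xy).
Proof.
move=> p0; rewrite -(marg_sum p Y (fun y => ln (marg p Y y))).
rewrite -(marg_sum p (fun w => (X w, Y w))
  (fun xy => ln (marg p (fun w => (X w, Y w)) xy))) -sumrB.
apply: eq_bigr => w _; rewrite -mulrBr.
have [->|pw] := eqVneq (p w) 0; first by rewrite !mul0r.
have {}pw : 0 < p w by rewrite lt_neqAle eq_sym pw p0.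
rewrite /cond_at /cond ln_div ?opprB// posrE.
  exact: (lt_le_trans pw (le_marg (fun w => (X w, Y w)) w p0)).
exact: (lt_le_trans pw (le_marg Y w p0)).
Qed.

Lemma expect_EFin p (f : Om -> R) : (forall w, 0 <= p w) ->
  expect p (fun w => (f w)%:E) = (\sum_w p w * f w)%:E.
Proof.
move=> p0; rewrite /expect big_mkcond -sumEFin; apply: eq_bigr => w _.
by case: ltP => // pw; rewrite (_ : p w = 0) ?mul0r//; apply/le_anti; rewrite pw p0.
Qed.

Lemma cond_entropyE p X Y : (forall w, 0 <= p w) ->
  cond_entropy p X Y = (rentropy p X Y)%:E.
Proof.
move=> p0; rewrite -expect_EFin//; apply: eq_bigr => w pw.
by rewrite lne_EFin//; exact: cond_at_gt0.
Qed.

End general.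

Lemma continuous_marg (Om A : finType) (X : Om -> A) x :
  continuous (fun p : {ptws Om -> R} => marg p X x).
Proof.
apply: continuous_big => [|w _]; first exact: add_continuous.
exact: continuous_ptws_eval.
Qed.

Section mixtures.
Context {C Z D E : finType} (d : C -> D).

Definition condDZ (s : C * Z -> R) (cz : C * Z) : R :=
  cond_at s (fun w => d w.1) snd cz.

Definition entropy_DZ (s : C * Z -> R) : R := rentropy s (fun w => d w.1) snd.

(* Agrees with entropy_DZ on nonnegative functions, but is continuous
   everywhere. *)
Definition entropy_DZ_ext (s : {ptws (C * Z)%type -> R}) : R :=
  \sum_z marg s snd z * ln (marg s snd z) -
  \sum_dz marg s (fun w => (d w.1, w.2)) dz *
    ln (marg s (fun w => (d w.1, w.2)) dz).

Lemma continuous_entropy_DZ_ext : continuous entropy_DZ_ext.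
Proof.
have c (A : finType) (X : C * Z -> A) : continuous
    (fun s : {ptws (C * Z)%type -> R} => \sum_x marg s X x * ln (marg s X x)).
  apply: continuous_sumr => x s.
  apply: (@continuous_comp _ _ _ (fun s : {ptws (C * Z)%type -> R} => marg s X x)
    (fun r => r * ln r)).
    exact: continuous_marg.
  exact: continuous_mulr_ln.
move=> s; exact: (cvgB (@c _ snd s) (@c _ (fun w => (d w.1, w.2)) s)).
Qed.

Lemma entropy_DZE s : (forall cz, 0 <= s cz) -> entropy_DZ s = entropy_DZ_ext s.
Proof. by move=> s0; rewrite /entropy_DZ rentropyE. Qed.

Lemma sum_pair (T U : finType) (F : T * U -> R) :
  \sum_w F w = \sum_t \sum_u F (t, u).
Proof. by rewrite pair_bigA; apply: eq_bigr => -[]. Qed.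

Lemma sum_slice (T : finType) (F : T * E -> R) (P : pred T) (Q : pred (T * E))
    (e : E) :
  (forall w, Q w = P w.1 && (w.2 == e)) ->
  \sum_(w | Q w) F w = \sum_(t | P t) F (t, e).
Proof.
move=> QE; rewrite (reindex_onto (fun t => (t, e)) fst) => [|[t e'] /=].
  by apply: eq_bigl => t; rewrite QE /= !eqxx !andbT.
by rewrite QE /= => /andP[_ /eqP ->].
Qed.

Variables (nu : C * Z * E -> R) (wt : E -> R) (s : E -> C * Z -> R).
Hypotheses (nuE : forall cz e, nu (cz, e) = wt e * s e cz).

(** Conditioning on e restricts both marginals to one slice, where the common factor [wt e]
    cancels. *)
Lemma cond_at_mixture cz e : wt e != 0 ->
  cond_at nu (fun w => d w.1.1) (fun w => (w.1.2, w.2)) (cz, e) =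
  condDZ (s e) cz.
Proof.
move=> we; rewrite /condDZ /cond_at /cond /=.
rewrite {1}/marg (@sum_slice _ _
  (fun w => (d w.1, w.2) == (d cz.1, cz.2)) _ e) => [|w]; last first.
  by rewrite !xpair_eqE andbA.
rewrite {1}/marg (@sum_slice _ _ (fun w => w.2 == cz.2) _ e) => [|w]; last first.
  by rewrite xpair_eqE.
under eq_bigr do rewrite nuE.
under [X in _ / X]eq_bigr do rewrite nuE.
by rewrite -!mulr_sumr invfM mulrACA mulfV// mul1r.
Qed.

Lemma entropy_mixture : (forall e, 0 <= wt e) -> (forall e cz, 0 <= s e cz) ->
  entropy_D_ZE d nu = (\sum_e wt e * entropy_DZ (s e))%:E.
Proof.
move=> w0 s0; have nu0 w : 0 <= nu w by case: w => cz e; rewrite nuE mulr_ge0.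
rewrite /entropy_D_ZE cond_entropyE//; congr EFin.
rewrite /rentropy sum_pair exchange_big.
apply: eq_bigr => e _; rewrite /entropy_DZ /rentropy mulr_sumr.
apply: eq_bigr => cz _; rewrite nuE.
have [->|we] := eqVneq (wt e) 0; first by rewrite !mul0r.
by rewrite cond_at_mixture// mulrA.
Qed.

End mixtures.

End conditional_entropy.

(** * Probability estimation factors and the gain rate *)

Section gain_rate.
Context {R : realType} {C Z D : finType} (d : C -> D).
Variables (M : set (C * Z -> R)) (rho : C * Z -> R).
Hypotheses (M_distr : forall sigma, M sigma -> is_distr sigma) (rho_M : M rho).

Lemma is_PEF_sum beta F s : is_PEF d M beta F -> M s ->
  \sum_cz s cz * (F cz * condDZ d s cz `^ beta) <= 1.
Proof.
move=> [_ PEF] Ms; have [s0 _] := M_distr Ms.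
by have := PEF s Ms; rewrite expect_EFin.
Qed.

Lemma PEF_of_functional (f : C * Z -> R) eps : 0 < eps ->
  (forall s, M s -> \sum_cz s cz * f cz <= entropy_DZ d s) ->
  exists beta F, [/\ 0 < beta, is_PEF d M beta F &
    log_prob_rate rho beta F = (\sum_cz rho cz * f cz - eps)%:E].
Proof.
move=> eps0 f_le.
(* [K] bounds the second moment of f - eps + ln sigma(D|Z) for all sigma in [M] at once, so one beta
   serves them all. [B] dominates every f - eps and keeps the exponents below the 1/3 of
   [expR_le_quadratic]. *)
pose K := \sum_cz (2 * (f cz - eps) ^+ 2 + 8).
pose B := 1 + \sum_cz `|f cz - eps|.
have K0 : 0 <= K by apply: sumr_ge0 => cz _; have := sqr_ge0 (f cz - eps); lra.
have B1 : 1 <= B by rewrite lerDl sumr_ge0.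
pose beta := Num.min (eps / (K + 1)) (3^-1 / B).
have beta0 : 0 < beta by rewrite lt_min !divr_gt0//; lra.
have betaK : beta * K <= eps.
  have : beta <= eps / (K + 1) by rewrite ge_min lexx.
  rewrite ler_pdivlMr; last by lra.
  by rewrite mulrDr mulr1; lra.
have betaB cz : beta * (f cz - eps) <= 3^-1.
  have : beta <= 3^-1 / B by rewrite ge_min lexx orbT.
  rewrite ler_pdivlMr; last by lra.
  apply: le_trans; rewrite ler_pM2l//.
  apply: (le_trans (ler_norm _)); rewrite /B (bigD1 cz)//=.
  have : 0 <= \sum_(i | i != cz) `|f i - eps| by exact: sumr_ge0.
  lra.
exists beta, (fun cz => expR (beta * (f cz - eps))); split=> //.
  split=> [cz|s Ms]; first exact: expR_ge0.
  have [s0 s1] := M_distr Ms.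
  rewrite expect_EFin// lee_fin.
  pose l cz := ln (condDZ d s cz).
  apply: (@le_trans _ _ (\sum_cz (s cz + beta * (s cz * (f cz - eps + l cz)) +
      beta ^+ 2 * (2 * (f cz - eps) ^+ 2 + 8)))).
    apply: ler_sum => cz _.
    have [s_eq0|s_neq0] := eqVneq (s cz) 0.
      rewrite s_eq0 !mul0r mulr0 !add0r mulr_ge0 ?sqr_ge0//.
      by have := sqr_ge0 (f cz - eps); lra.
    have spos : 0 < s cz by rewrite lt_neqAle eq_sym s_neq0 s0.
    have tpos : 0 < condDZ d s cz by exact: cond_at_gt0.
    have t1 : condDZ d s cz <= 1 by exact: cond_at_le1.
    have st : s cz <= condDZ d s cz by exact: le_cond_at.
    have l0 : l cz <= 0 by exact: ln_le0.
    have sl : s cz * l cz ^+ 2 <= 4.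
      apply: le_trans (mulr_ln_sqr_le4 tpos t1).
      by rewrite ler_wpM2r// sqr_ge0.
    have -> : expR (beta * (f cz - eps)) * condDZ d s cz `^ beta =
        expR (beta * (f cz - eps + l cz)).
      by rewrite /powR gt_eqF// [beta * (_ + l cz)]mulrDr expRD.
    (* As l <= 0, the bound on beta (f - eps) alone suffices. *)
    have x3 : beta * (f cz - eps + l cz) <= 3^-1.
      by have := betaB cz; rewrite mulrDr; nra.
    apply: (le_trans (ler_wpM2l (s0 cz) (expR_le_quadratic x3))).
    (* Use (a + l)^2 = 2 a^2 + 2 l^2 - (a - l)^2 with s <= 1 and s l^2 <= 4. *)
    have quad : s cz * (f cz - eps + l cz) ^+ 2 <= 2 * (f cz - eps) ^+ 2 + 8.
      have s_le1 : s cz <= 1 by exact: le_trans st t1.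
      have := ler_wpM2r (sqr_ge0 (f cz - eps)) s_le1.
      have := mulr_ge0 (s0 cz) (sqr_ge0 (f cz - eps - l cz)).
      rewrite !expr2 in sl *; nra.
    have := ler_wpM2l (sqr_ge0 beta) quad; nra.
  rewrite !big_split /= s1 -!mulr_sumr -/K.
  have -> : \sum_cz s cz * (f cz - eps + l cz) =
      \sum_cz s cz * f cz - eps - entropy_DZ d s.
    rewrite /entropy_DZ /rentropy.
    under eq_bigr do rewrite mulrDr mulrBr.
    rewrite big_split sumrB /= -mulr_suml s1 mul1r -sumrN; congr (_ + _).
    by apply: eq_bigr => cz _; rewrite mulrN opprK.
  (* The total is at most 1 + beta (beta K - eps), and beta K <= eps. *)
  have := f_le s Ms; nra.
have [rho0 rho1] := M_distr rho_M.
rewrite /log_prob_rate.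
have -> : expect rho (fun cz => lne (expR (beta * (f cz - eps)))%:E) =
    (beta * (\sum_cz rho cz * f cz - eps))%:E.
  transitivity (expect rho (fun cz => (beta * (f cz - eps))%:E)).
    by apply: eq_bigr => cz _; rewrite lne_EFin ?expR_gt0// expRK.
  rewrite expect_EFin//; congr EFin.
  under eq_bigr do rewrite mulrCA mulrBr.
  by rewrite -mulr_sumr sumrB -mulr_suml rho1 mul1r.
by rewrite -EFinM mulrAC mulfV ?mul1r// gt_eqF.
Qed.

(** Write ln F = - beta ln t + ln (F t^beta) and use ln y <= y - 1. This tangent bound stands in for
    Jensen's inequality and can be averaged term by term. *)
Lemma ln_PEF_le (F t beta : R) : 0 <= F -> 0 < t ->
  (lne F%:E <= (beta * - ln t + F * t `^ beta - 1)%:E)%E.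
Proof.
move=> F0 t0; have [F_gt0|F_le0] := ltP 0 F; last first.
  by rewrite le0_lneNy ?lee_fin// leNye.
rewrite lne_EFin// lee_fin.
have tb : 0 < t `^ beta by exact: powR_gt0.
have Ftb : -1 < F * t `^ beta - 1 by rewrite ltrBrDr addNr mulr_gt0.
by have := le_ln1Dx Ftb; rewrite [1 + _]addrC subrK lnM ?posrE// ln_powR; lra.
Qed.

(** Apply [ln_PEF_le] with the conditional probabilities of each component [s e]; the PEF inequality
    at [s e] makes the mean of F t^beta - 1 nonpositive, leaving beta times the entropy. *)
Lemma log_prob_rate_le (E : finType) (wt : E -> R) (s : E -> C * Z -> R) beta F :
  0 < beta -> is_PEF d M beta F ->
  (forall e, 0 <= wt e) -> (forall e, 0 < wt e -> M (s e)) ->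
  (forall cz, \sum_e wt e * s e cz = rho cz) ->
  (log_prob_rate rho beta F <= (\sum_e wt e * entropy_DZ d (s e))%:E)%E.
Proof.
move=> beta0 PEF w0 sM rhoE; have [rho0 rho1] := M_distr rho_M.
have ws0 e cz : 0 <= wt e * s e cz.
  have [->|we] := eqVneq (wt e) 0; first by rewrite mul0r.
  have we0 : 0 < wt e by rewrite lt_neqAle eq_sym we w0.
  by rewrite mulr_ge0//; have [] := M_distr (sM e we0).
pose G e cz := beta * - ln (condDZ d (s e) cz) +
  F cz * condDZ d (s e) cz `^ beta - 1.
have boundE : (expect rho (fun cz => lne (F cz)%:E) <=
    (\sum_cz \sum_e wt e * s e cz * G e cz)%:E)%E.
  rewrite /expect big_mkcond -sumEFin; apply: lee_sum => cz _.
  have term0 e : wt e * s e cz = 0 \/ 0 < wt e * s e cz.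
    have [->|ne] := eqVneq (wt e * s e cz) 0; [by left|right].
    by rewrite lt_neqAle eq_sym ne ws0.
  have lneG e : 0 < wt e * s e cz -> (lne (F cz)%:E <= (G e cz)%:E)%E.
    move=> wse; apply: ln_PEF_le; first by case: PEF.
    have we : 0 < wt e.
      by rewrite lt_neqAle w0 andbT; apply: contraTneq wse => <-; rewrite mul0r ltxx.
    have [s0 _] := M_distr (sM e we).
    by apply: cond_at_gt0 => //; rewrite -(pmulr_rgt0 _ we).
  case: ltP => [rho_gt0|rho_le0]; last first.
    have ws e : wt e * s e cz = 0.
      apply/le_anti; rewrite ws0 andbT; apply: le_trans rho_le0.
      by rewrite -rhoE (bigD1 e)//= lerDl sumr_ge0.
    by rewrite big1 // => e _; rewrite ws mul0r.
  have [F_gt0|F_le0] := ltP 0 (F cz); last first.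
    by rewrite le0_lneNy ?lee_fin// gt0_muleNy ?lte_fin// leNye.
  rewrite lne_EFin// -EFinM lee_fin -rhoE mulr_suml.
  apply: ler_sum => e _; have [->|wse] := term0 e; first by rewrite !mul0r.
  by rewrite ler_pM2l// -lee_fin -lne_EFin// lneG.
have sum_le : \sum_cz \sum_e wt e * s e cz * G e cz <=
    beta * \sum_e wt e * entropy_DZ d (s e).
  rewrite exchange_big mulr_sumr; apply: ler_sum => e _.
  have [->|we] := eqVneq (wt e) 0.
    by rewrite mul0r mulr0 big1// => cz _; rewrite !mul0r.
  have we0 : 0 < wt e by rewrite lt_neqAle eq_sym we w0.
  have [s0 s1] := M_distr (sM e we0).
  under eq_bigr do rewrite -mulrA.
  rewrite -mulr_sumr mulrCA ler_pM2l//.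
  have -> : \sum_cz s e cz * G e cz = beta * entropy_DZ d (s e) +
      \sum_cz s e cz * (F cz * condDZ d (s e) cz `^ beta) - 1.
    rewrite -s1 /entropy_DZ /rentropy mulr_sumr -big_split -sumrB /=.
    by apply: eq_bigr => cz _; rewrite /G /condDZ; ring.
  have := is_PEF_sum PEF (sM e we0); lra.
rewrite /log_prob_rate lee_pdivrMr//.
by apply: (le_trans boundE); rewrite -EFinM lee_fin [leRHS]mulrC.
Qed.

Lemma gain_rate_le_entropy (E : finType) (nu : C * Z * E -> R) :
  is_extension M rho nu ->
  (asymptotic_gain_rate d M rho <= entropy_D_ZE d nu)%E.
Proof.
move=> [[nu0 nu1] nu_rho nuM].
pose wt := marg nu snd; pose s e := cond nu fst snd e.
have margE cz e : marg nu (fun w => (w.1, w.2)) (cz, e) = nu (cz, e).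
  by rewrite /marg (big_pred1 (cz, e))// => -[].
have w0 e : 0 <= wt e by exact: sumr_ge0.
have s0 e cz : 0 <= s e cz by rewrite /s /cond margE divr_ge0.
have nuE cz e : nu (cz, e) = wt e * s e cz.
  (* On a slice of weight zero the conditional is the zero function by convention, and [nu] vanishes
     there as well. *)
  rewrite /s /cond margE -/(wt e); have [we|we] := eqVneq (wt e) 0.
    rewrite we mul0r; apply/le_anti; rewrite nu0 andbT -we.
    exact: (le_marg snd (cz, e) nu0).
  by rewrite mulrCA mulfV// mulr1.
rewrite (entropy_mixture d nuE)//; apply: ge_ereal_sup => _ [beta [F [b0 PEF ->]]].
apply: log_prob_rate_le => // cz; rewrite -nu_rho /marg.
under eq_bigr do rewrite -nuE.
rewrite [RHS](reindex_onto (pair cz) snd) => [|[c e] /= /eqP ->]//.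
by apply: eq_bigl => e; rewrite !eqxx.
Qed.
End gain_rate.

(** * Upper bound on the gain rate and its attainment *)

Theorem theorem43 (R : realType) (C Z D : finType) (d : C -> D)
    (M : set (C * Z -> R))
    (M_distr : forall sigma, M sigma -> is_distr sigma)
    (M_closed : closed (M : set {ptws (C * Z)%type -> R}))
    (rho : C * Z -> R) (rho_M : M rho) :
  (forall (E : finType) (nu : C * Z * E -> R),
     is_extension M rho nu ->
     (asymptotic_gain_rate d M rho <= entropy_D_ZE d nu)%E) /\
  (exists N : nat, forall E : finType, (N <= #|E|)%N ->
     exists nu : C * Z * E -> R,
       is_extension M rho nu /\
       asymptotic_gain_rate d M rho = entropy_D_ZE d nu).
Proof.
split=> [E nu|]; first exact: gain_rate_le_entropy.
(* One atom for each coordinate of the entropy graph: the base coordinates and the height. *)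
exists #|{: C * Z}|.+1 => E cardE.
have [x [[x0 x1 xM] x_rho x_opt]] := optimal_mixture M_distr M_closed
  (@continuous_entropy_DZ_ext R C Z D d) rho_M cardE.
pose nu (w : C * Z * E) := x (w.2, None) * x (w.2, Some w.1).
have nuE cz e : nu (cz, e) = x (e, None) * atom e x cz by [].
have s0 e cz : 0 <= atom e x cz by have [] := M_distr _ (xM e).
have marg_nu e : marg nu snd e = x (e, None).
  rewrite /marg (reindex_onto (fun cz => (cz, e)) fst) => [|[cz e'] /= /eqP ->]//.
  under eq_bigl do rewrite !eqxx.
  by under eq_bigr do rewrite nuE; rewrite -mulr_sumr;
    have [_ ->] := M_distr _ (xM e); rewrite mulr1.
have nu_ext : is_extension M rho nu.
  split.
  - split=> [[cz e]|]; first by rewrite nuE mulr_ge0.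
    by rewrite -x1 -(sum_marg nu snd); apply: eq_bigr => e _; rewrite marg_nu.
  - apply/funext => cz; rewrite -x_rho /marg.
    rewrite (reindex_onto (pair cz) snd) => [|[c e] /= /eqP ->]//.
    by apply: eq_bigl => e; rewrite !eqxx.
  - move=> e; rewrite marg_nu => xe.
    suff -> : cond nu fst snd e = atom e x by exact: xM.
    apply/funext => cz; rewrite /cond marg_nu /marg (big_pred1 (cz, e)) => [|[]]//.
    by rewrite nuE mulrC mulKf// gt_eqF.
exists nu; split=> //; apply/le_anti/andP; split.
  exact: gain_rate_le_entropy.
rewrite (entropy_mixture d nuE)//.
have -> : \sum_e x (e, None) * entropy_DZ d (atom e x) =
    mixture (@entropy_DZ_ext R C Z D d) None x.
  by apply: eq_bigr => e _; rewrite entropy_DZE.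
apply/lee_subgt0Pr => eps eps0.
(* Half of eps is lost in the separation, the other half in turning f into a PEF. *)
have eps2 : 0 < eps / 2 by rewrite divr_gt0.
have [f [f_le f_rho]] := x_opt _ eps2.
have [] := @PEF_of_functional _ _ _ _ d M rho M_distr rho_M f _ eps2.
  move=> s Ms; rewrite entropy_DZE ?f_le//.
  by have [] := M_distr _ Ms.
move=> beta [F [beta0 PEF rate]].
apply: (@le_trans _ _ (log_prob_rate rho beta F)).
  by rewrite rate f_rho -EFinB lee_fin; lra.
by apply: ereal_sup_ubound; exists beta, F.
Qed.
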